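(* Let $(\varphi_1,\varphi_2):[t_0,\vartheta_0]\times\mathbb{R}^n\to\mathbb{R}^2$ be differentiable with $(\varphi_1(\vartheta_0,\cdot),\varphi_2(\vartheta_0,\cdot))=(\sigma_1(\cdot),\sigma_2(\cdot))$. Suppose that for every position $(t,x)\in[t_0,\vartheta_0]\times\mathbb{R}^n$ there exist $u^n\in P$, $v^n\in Q$ such that $$\max_{u\in P}\langle\nabla\varphi_1(t,x),f(t,x,u,v^n)\rangle=\langle\nabla\varphi_1(t,x),f(t,x,u^n,v^n)\rangle,$$ $$\max_{v\in Q}\langle\nabla\varphi_2(t,x),f(t,x,u^n,v)\rangle=\langle\nabla\varphi_2(t,x),f(t,x,u^n,v^n)\rangle,$$ and $$\frac{\partial\varphi_i(t,x)}{\partial t}+\langle\nabla\varphi_i(t,x),f(t,x,u^n,v^n)\rangle=0,\qquad i=1,2.$$ Then $(\varphi_1,\varphi_2)$ satisfies the following conditions: it is continuous; $(\varphi_1(\vartheta_0,\cdot),\varphi_2(\vartheta_0,\cdot))=(\sigma_1(\cdot),\sigma_2(\cdot))$; for each $i=1,2$ the function $\varphi_i$ is an upper viscosity solution of $$\frac{\partial\varphi_i}{\partial t}+H_i(t,x,\nabla\varphi_i)=0;$$ and for all $(t,x)\in[t_0,\vartheta_0)\times\mathbb{R}^n$ $$\inf_{w\in\mathcal{F}(t,x)}\mathrm{d}_{abs}(\varphi_1,\varphi_2)(t,x;w)=0.$$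
   Context: Let $t_0<\vartheta_0$, let $P,Q$ be nonempty compact sets, let $f:[t_0,\vartheta_0]\times\mathbb{R}^n\times P\times Q\to\mathbb{R}^n$ and $\sigma_1,\sigma_2:\mathbb{R}^n\to\mathbb{R}$ be continuous, with $f$ Lipschitz continuous with respect to $x$ and of sublinear growth in $x$ (i.e. $\|f(t,x,u,v)\|\le K(1+\|x\|)$). The Isaacs condition holds: for all $t\in[t_0,\vartheta_0]$, $x,s\in\mathbb{R}^n$, $\min_{u\in P}\max_{v\in Q}\langle s,f(t,x,u,v)\rangle=\max_{v\in Q}\min_{u\in P}\langle s,f(t,x,u,v)\rangle$. Here $\nabla$ denotes the gradient in $x$; at $t=t_0$ and $t=\vartheta_0$ differentiability is understood relative to the domain $[t_0,\vartheta_0]\times\mathbb{R}^n$. Put $\mathcal{F}(t,x)=\mathrm{co}\{f(t,x,u,v):u\in P,v\in Q\}$ (convex hull), $$H_1(t,x,s)=\max_{u\in P}\min_{v\in Q}\langle s,f(t,x,u,v)\rangle,\qquad H_2(t,x,s)=\max_{v\in Q}\min_{u\in P}\langle s,f(t,x,u,v)\rangle.$$ For $(c_1,c_2):[t_0,\vartheta_0]\times\mathbb{R}^n\to\mathbb{R}^2$, $(t,x)\in[t_0,\vartheta_0)\times\mathbb{R}^n$, $w\in\mathbb{R}^n$, $$\mathrm{d}_{abs}(c_1,c_2)(t,x;w)=\liminf_{\delta\downarrow0,\ w'\to w}\frac{|c_1(t+\delta,x+\delta w')-c_1(t,x)|+|c_2(t+\delta,x+\delta w')-c_2(t,x)|}{\delta}.$$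 A continuous function $c$ is an upper viscosity solution of $\partial c/\partial t+H(t,x,\nabla c)=0$ if $a+H(t,x,s)\le0$ for all $(t,x)\in(t_0,\vartheta_0)\times\mathbb{R}^n$ and all $(a,s)\in D^-c(t,x)$, where the subdifferential $D^-c(t,x)$ is the set of $(a,s)\in\mathbb{R}\times\mathbb{R}^n$ with $$\liminf_{(\tau,y)\to(t,x)}\frac{c(\tau,y)-c(t,x)-a(\tau-t)-\langle s,y-x\rangle}{|\tau-t|+\|y-x\|}\ge0.$$ *)

(* Defs.v *)
From HB Require Import structures.
From mathcomp Require Import all_boot all_order all_algebra.
From mathcomp Require Import all_classical all_reals all_analysis.

Set Implicit Arguments.
Unset Strict Implicit.
Unset Printing Implicit Defensive.

Import Order.TTheory GRing.Theory Num.Theory.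
Import numFieldNormedType.Exports.

Local Open Scope classical_set_scope.
Local Open Scope ring_scope.

Section Euclidean.
Context {R : realType} {n : nat}.
Implicit Types x y : 'rV[R]_n.

Definition dot x y : R := \sum_(i < n) x ord0 i * y ord0 i.

(* The library norm on 'rV[R]_n is the sup norm; it induces the same topology,
   but every norm written explicitly below is the Euclidean one. *)
Definition enorm x : R := Num.sqrt (dot x x).

End Euclidean.

Section Extrema.
Context {R : realType} {T : Type}.

(* The value is 0 if the extremum is not attained, which does not happen for
   continuous g on a nonempty compact set. *)
Definition max_on (A : set T) (g : T -> R) : R :=
  xget 0 (g @` A `&` ubound (g @` A)).

Definition min_on (A : set T) (g : T -> R) : R :=
  xget 0 (g @` A `&` lbound (g @` A)).

End Extrema.

Definition co {R : realType} {n : nat} (A : set 'rV[R]_n) : set 'rV[R]_n :=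
  smallest (@convex_set R 'rV[R]_n) A.

(* A function on [t0, T] x R^n is represented by a total function of the pair
   (t, x); its values outside the strip are irrelevant. *)
Definition strip {R : realType} (n : nat) (t0 T : R) : set (R * 'rV[R]_n) :=
  [set` `[t0, T]] `*` setT.
Arguments strip {R} n t0 T.

Section RelativeDifferentiation.
Context {R : realType} {n : nat} (t0 T : R).
Implicit Types (c : R * 'rV[R]_n -> R) (p : R * 'rV[R]_n).

(* The filter of neighbourhoods of p relative to the strip: differentiating
   along it gives the usual differential for t0 < p.1 < T, and
   differentiability relative to the strip for p.1 = t0 and p.1 = T. *)
Definition strip_nbhs p := within (strip n t0 T) (nbhs p).

Definition differentiable_on_strip c : Prop :=
  forall p, strip n t0 T p -> differentiable c (strip_nbhs p).

Definition dt c p : R := 'd c (strip_nbhs p) (1, 0).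

Definition grad c p : 'rV[R]_n :=
  \row_(j < n) 'd c (strip_nbhs p) (0, delta_mx ord0 j).

End RelativeDifferentiation.

Section Game.
Context {R : realType} {n : nat} {U V : Type}.
Variables (P : set U) (Q : set V) (f : R -> 'rV[R]_n -> U -> V -> 'rV[R]_n).
Implicit Types (t : R) (x s : 'rV[R]_n).

Definition isaacs (t0 T : R) : Prop :=
  forall t x s, t \in `[t0, T] ->
    min_on P (fun u => max_on Q (fun v => dot s (f t x u v))) =
    max_on Q (fun v => min_on P (fun u => dot s (f t x u v))).

Definition velocities t x : set 'rV[R]_n :=
  co [set f t x z.1 z.2 | z in P `*` Q].

Definition H1 t x s : R :=
  max_on P (fun u => min_on Q (fun v => dot s (f t x u v))).

Definition H2 t x s : R :=
  max_on Q (fun v => min_on P (fun u => dot s (f t x u v))).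

End Game.

Section ValueFunctions.
Context {R : realType} {n : nat}.
Implicit Types c : R * 'rV[R]_n -> R.
Local Open Scope ereal_scope.

Definition d_abs c1 c2 (t : R) (x w : 'rV[R]_n) : \bar R :=
  limf_einf
    (fun z : R * 'rV[R]_n =>
      ((`|c1 (t + z.1, x + z.1 *: z.2) - c1 (t, x)| +
        `|c2 (t + z.1, x + z.1 *: z.2) - c2 (t, x)|) / z.1)%R%:E)
    (filter_prod (0%R)^'+ (nbhs w)).

Definition subdifferential c (t : R) (x : 'rV[R]_n) : set (R * 'rV[R]_n) :=
  [set q | 0 <= limf_einf
    (fun z : R * 'rV[R]_n =>
      ((c z - c (t, x) - q.1 * (z.1 - t) - dot q.2 (z.2 - x)) /
       (`|z.1 - t| + enorm (z.2 - x)))%R%:E)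
    (t, x)^'].

(* Upper viscosity solution of dc/dt + H(t, x, grad c) = 0 on the strip. *)
Definition upper_viscosity_solution (t0 T : R)
    (H : R -> 'rV[R]_n -> 'rV[R]_n -> R) c : Prop :=
  {within strip n t0 T, continuous c} /\
  forall (t : R) (x : 'rV[R]_n), t \in `]t0, T[ ->
    forall (a : R) (s : 'rV[R]_n), subdifferential c t x (a, s) ->
      (a + H t x s <= 0)%R.

End ValueFunctions.

(* Main.v *)
(* Differentiability forces a subgradient (a, s) at an interior point to be
   (dphi_i/dt, grad phi_i). The maximum over one player's controls of the minimum
   over the other's is at most the maximum with the other player's control frozen
   at its equilibrium value, that is, - dphi_i/dt. Along the equilibrium velocity
   f(t, x, un, vn) both difference quotients tend to 0, so the infimum of d_abs,
   which is nonnegative, vanishes. *)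
Require Import Defs.
From mathcomp Require Import all_boot all_order all_algebra.
From mathcomp Require Import all_classical all_reals all_analysis.
From mathcomp Require Import lra.

Set Implicit Arguments.
Unset Strict Implicit.
Unset Printing Implicit Defensive.

Import Order.TTheory GRing.Theory Num.Theory.
Import numFieldNormedType.Exports.

Local Open Scope classical_set_scope.
Local Open Scope ring_scope.

(** * Attained extrema and the max-min inequality *)

Section MaxMin.
Context {R : realType}.

Lemma max_onE {T : Type} (A : set T) (g : T -> R) (u : T) :
  A u -> (forall v, A v -> g v <= g u) -> max_on A g = g u.
Proof.
move=> Au gu; rewrite /max_on.
have [|[v Av <-] ub] := @xgetPex _ 0 (g @` A `&` ubound (g @` A)).
  by exists (g u); split; [exists u|move=> _ [v Av <-]; exact: gu].
by apply/eqP; rewrite eq_le gu//=; apply: ub; exists u.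
Qed.

Lemma min_onE {T : Type} (A : set T) (g : T -> R) (u : T) :
  A u -> (forall v, A v -> g u <= g v) -> min_on A g = g u.
Proof.
move=> Au gu; rewrite /min_on.
have [|[v Av <-] lb] := @xgetPex _ 0 (g @` A `&` lbound (g @` A)).
  by exists (g u); split; [exists u|move=> _ [v Av <-]; exact: gu].
by apply/eqP; rewrite eq_le gu// andbT; apply: lb; exists u.
Qed.

(** The superlevel sets [B u] are nested, so they generate a proper filter on the compact set [A]. A
    cluster point [u] of this filter is a maximiser. *)
Lemma usc_compact_max {T : topologicalType} (A : set T) (g : T -> R) :
  A !=set0 -> compact A ->
  (forall u a, A u -> g u < a -> \forall v \near within A (nbhs u), g v < a) ->
  exists2 u, A u & forall v, A v -> g v <= g u.
Proof.
move=> A0 cA uscg.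
pose B u := [set v | A v /\ g u <= g v].
have BF : ProperFilter (filter_from A B).
  apply: filter_from_proper; first apply: filter_from_filter => //.
    move=> u v Au Av; have [uv|/ltW vu] := leP (g u) (g v).
      by exists v => // w [Aw vw]; split; split=> //; exact: le_trans uv vw.
    by exists u => // w [Aw uw]; split; split=> //; exact: le_trans vu uw.
  by move=> u Au; exists u.
have [|u [Au ucl]] := cA _ BF.
  by have [u Au] := A0; exists u => // v [].
exists u => // v Av; rewrite leNgt; apply/negP => uv.
(* If [g u < g v], semicontinuity keeps [g] below [g v] on [A] near [u], while clustering puts a
   point of [B v] there. *)
have [w [[Aw vw] /(_ Aw)]] := ucl _ _ (ex_intro2 _ _ v Av (fun _ => id))
  (uscg _ _ Au uv).
by rewrite ltNge vw.
Qed.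

(* The inner minimum is upper semicontinuous in the outer variable, being an
   infimum of continuous functions; hence the outer maximum is attained and
   does not take the junk value 0. *)
Lemma max_min_le_max {U V : topologicalType} (P : set U) (Q : set V)
    (g : U -> V -> R) (v0 : V) :
  P !=set0 -> compact P -> compact Q ->
  (forall v, Q v -> {within P, continuous g^~ v}) ->
  (forall u, P u -> {within Q, continuous g u}) ->
  Q v0 ->
  max_on P (fun u => min_on Q (g u)) <= max_on P (g^~ v0).
Proof.
move=> P0 cP cQ gcP gcQ Qv0.
have Q0 : Q !=set0 by exists v0.
have minP u : P u -> exists2 v, Q v &
    min_on Q (g u) = g u v /\ forall w, Q w -> g u v <= g u w.
  move=> Pu; have [v] := compact_EVT_min Q0 cQ (gcQ u Pu).
  rewrite inE => Qv vmin; have vle w : Q w -> g u v <= g u w.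
    by move=> Qw; apply: vmin; rewrite inE.
  by exists v => //; split=> //; exact: min_onE.
have min_le u v : P u -> Q v -> min_on Q (g u) <= g u v.
  by move=> Pu Qv; have [w _ [-> ]] := minP u Pu; exact.
have [|u Pu umax] := @usc_compact_max _ P (fun u => min_on Q (g u)) P0 cP.
  (* Freeze [v] at the minimiser for [u]: near [u] the continuous function [g^~ v] stays below [a]
     and dominates the inner minimum. *)
  move=> u a Pu; have [v Qv [-> _]] := minP u Pu => gua.
  have : \forall w \near within P (nbhs u), g w v < a.
    have /subspace_continuousP/(_ u Pu) gcu := gcP v Qv.
    exact: gcu (lt_nbhsl gua).
  rewrite !near_withinE; apply: filterS => w gw Pw.
  exact: le_lt_trans (min_le _ _ Pw Qv) (gw Pw).
have [w] := compact_EVT_max P0 cP (gcP v0 Qv0).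
rewrite inE => Pw wmax.
rewrite (max_onE Pu umax) (@max_onE _ _ _ w)//; last first.
  by move=> v Pv; apply: wmax; rewrite inE.
apply: le_trans (min_le _ _ Pu Qv0) _.
by apply: wmax; rewrite inE.
Qed.

End MaxMin.

(** Serves to pass from joint continuity of the dynamics to continuity in a single control, [m]
    being the insertion that freezes the other arguments. *)
Lemma within_continuous_comp {X Y Z : topologicalType} (A : set X) (B : set Y)
    (m : X -> Y) (g : Y -> Z) :
  continuous m -> (forall x, A x -> B (m x)) -> {within B, continuous g} ->
  {within A, continuous (fun x => g (m x))}.
Proof.
move=> mc AB /subspace_continuousP gc; apply/subspace_continuousP => x Ax.
move=> C /(gc (m x) (AB x Ax))/(mc x) mC.
have {}mC : \forall y \near x, B (m y) -> C (g (m y)) by [].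
suff : \forall y \near x, A y -> C (g (m y)) by [].
by apply: filterS mC => y gC Ay; apply: gC; exact: AB.
Qed.

(** * Euclidean inner product and norm *)

Section Dot.
Context {R : realType} {n : nat}.
Implicit Types x y s : 'rV[R]_n.

Lemma dotNr s x : dot s (- x) = - dot s x.
Proof. by rewrite /dot -sumrN; apply: eq_bigr => i _; rewrite mxE mulrN. Qed.

Lemma dotZr s (a : R) x : dot s (a *: x) = a * dot s x.
Proof.
by rewrite /dot mulr_sumr; apply: eq_bigr => i _; rewrite mxE mulrCA.
Qed.

Lemma dot_delta s (j : 'I_n) : dot s (delta_mx ord0 j) = s ord0 j.
Proof.
rewrite /dot (bigD1 j)//= mxE !eqxx mulr1 big1 ?addr0// => i ij.
by rewrite mxE (negbTE ij) andbF mulr0.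
Qed.

Lemma dot0r s : dot s 0 = 0.
Proof. by rewrite -(scale0r (0 : 'rV[R]_n)) dotZr mul0r. Qed.

Lemma continuous_dot s : continuous (dot s).
Proof.
apply: continuous_big => [|i _ x]; first exact: add_continuous.
apply: (@cvgMl_tmp _ _ _ (nbhs_filter x) (fun y : 'rV_n => y ord0 i)).
exact: coord_continuous.
Qed.

Lemma enormZ (a : R) x : enorm (a *: x) = `|a| * enorm x.
Proof.
rewrite /enorm dotZr [dot (a *: x) x](_ : _ = a * dot x x).
  by rewrite mulrA -expr2 sqrtrM ?sqr_ge0// sqrtr_sqr.
by rewrite -dotZr /dot; apply: eq_bigr => i _; rewrite mulrC.
Qed.

Lemma enorm_ge0 x : 0 <= enorm x. Proof. exact: sqrtr_ge0. Qed.

Lemma enorm_eq0 x : enorm x = 0 -> x = 0.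
Proof.
move=> /eqP; rewrite sqrtr_eq0 => x0.
have sq_ge0 (i : 'I_n) : 0 <= x ord0 i * x ord0 i by rewrite -expr2 sqr_ge0.
have /eqP : dot x x = 0 by apply/le_anti; rewrite x0/= sumr_ge0.
rewrite psumr_eq0// => /allP xi0; apply/rowP => i; rewrite mxE.
by have /(_ (mem_index_enum i)) := xi0 i; rewrite /= mulf_eq0 orbb => /eqP.
Qed.

End Dot.

(** * Differentiation relative to the strip *)

Section Strip.
Context {R : realType} {n : nat} (t0 T : R).
Implicit Types (c : R * 'rV[R]_n -> R) (p : R * 'rV[R]_n).

(** The differential along a filter is expanded around the [lim] of that filter, which has to be
    identified with [p]. The filter is proper because [p] lies in the strip, and limits are unique
    in a normed space. *)
Lemma lim_strip_nbhs p : strip n t0 T p ->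
  lim (T := (R * 'rV[R]_n)%type : normedModType R) (strip_nbhs t0 T p) = p.
Proof.
move=> Sp; have FF : ProperFilter (strip_nbhs t0 T p).
  by apply: within_nbhs_proper; exact: subset_closure.
have sp : id @ strip_nbhs t0 T p --> p by exact: cvg_within.
exact: (cvg_lim (@norm_hausdorff _ _) sp).
Qed.

Lemma strip_diff_near c p : strip n t0 T p ->
  differentiable c (strip_nbhs t0 T p) ->
  forall e, 0 < e -> \forall z \near strip_nbhs t0 T p,
    `|c z - c p - 'd c (strip_nbhs t0 T p) (z - p)| <= e * `|z - p|.
Proof.
move=> Sp [[_ dc]] e e0.
move: dc => /eqaddoP/(_ e e0).
rewrite (lim_strip_nbhs Sp); apply: filterS => z /=.
by rewrite /= opprD addrA.
Qed.

(** Pulls the first-order estimate back along a path or family [m] tending to [p]. It is applied to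
    [(t + z.1, x + z.1 *: z.2)] and to rays from [p]. *)
Lemma strip_diff_cvg {I : Type} {F : set_system I} {FF : Filter F} c p
    (m : I -> R * 'rV[R]_n) :
  strip n t0 T p -> differentiable c (strip_nbhs t0 T p) ->
  m @ F --> p -> (\forall i \near F, strip n t0 T (m i)) ->
  forall e, 0 < e -> \forall i \near F,
    `|c (m i) - c p - 'd c (strip_nbhs t0 T p) (m i - p)| <= e * `|m i - p|.
Proof.
move=> Sp dc mp mS e e0.
have := mp _ (strip_diff_near Sp dc e0).
by apply: filterS2 mS => i mSi; apply.
Qed.

(** By linearity, after expanding [h] in the basis formed by [(1, 0)] and the
    [(0, delta_mx ord0 j)]. *)
Lemma diff_stripE c p (h : R * 'rV[R]_n) :
  'd c (strip_nbhs t0 T p) h = h.1 * dt t0 T c p + dot (grad t0 T c p) h.2.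
Proof.
rewrite /dt /grad; set d := 'd c (strip_nbhs t0 T p).
have hE : h = h.1 *: (1, 0) + \sum_(j < n) h.2 ord0 j *: (0, delta_mx ord0 j).
  apply: injective_projections => /=.
    rewrite [LHS](_ : _ = h.1 *: 1 + 0); last by rewrite addr0 [RHS]mulr1.
    congr +%R; rewrite (big_morph fst (fun x y => erefl) erefl)/=.
    by rewrite big1// => j _; rewrite [LHS]mulr0.
  rewrite scaler0 add0r (big_morph snd (fun x y => erefl) erefl)/=.
  by rewrite [LHS]row_sum_delta.
rewrite {1}hE linearD linearZ linear_sum /=; congr (_ + _).
by apply: eq_bigr => j _; rewrite linearZ/= mxE [LHS]mulrC.
Qed.

Lemma diff_strip_continuous c p : strip n t0 T p ->
  differentiable c (strip_nbhs t0 T p) ->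
  c @ within (strip n t0 T) (nbhs p) --> c p.
Proof.
move=> Sp dc; have [[dcont _]] := dc.
have sp : (z - p) @[z --> within (strip n t0 T) (nbhs p)] --> (0 : R * 'rV[R]_n).
  rewrite -(subrr p); apply: cvgB; [exact: cvg_within|exact: cvg_cst].
have /cvgr0Pnorm_lt dz : 'd c (strip_nbhs t0 T p) (z - p)
    @[z --> within (strip n t0 T) (nbhs p)] --> (0 : R).
  rewrite -(linear0 ('d c (strip_nbhs t0 T p))).
  exact: (@continuous_cvg _ _ _ _ _ _ _ _ (dcont 0)).
apply/cvgrPdistC_lt => e e0.
have e2 : 0 < e / 2 by rewrite divr_gt0.
move/cvgr0Pnorm_lt : sp => /(_ _ e2) sp.
(* With tolerance 1 the remainder is at most the norm of [z - p]; it and the linear part each stay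
   below [e / 2]. *)
apply: filterS3 (dz _ e2) sp (strip_diff_near Sp dc ltr01) => z.
set d := 'd c (strip_nbhs t0 T p) _ => d2 z2; rewrite mul1r => cd.
rewrite -(subrK d (c z - c p)) (le_lt_trans (ler_normD _ _))//.
by rewrite [ltRHS]splitr ltrD// (le_lt_trans cd).
Qed.

(** The displacement is [z.1 *: (1, z.2)], so division by [z.1] leaves the differential at
    [(1, z.2)] plus a vanishing error. Continuity of the differential then lets [z.2] tend to
    [w]. *)
Lemma diff_quotient_cvg c t (x w : 'rV[R]_n) : t \in `[t0, T[ ->
  differentiable c (strip_nbhs t0 T (t, x)) ->
  (c (t + z.1, x + z.1 *: z.2) - c (t, x)) / z.1
    @[z --> filter_prod (0 : R)^'+ (nbhs w)] -->
  dt t0 T c (t, x) + dot (grad t0 T c (t, x)) w.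
Proof.
move=> /andP[t0t tT] dc.
rewrite bnd_simp in t0t; rewrite bnd_simp in tT.
have Sp : strip n t0 T (t, x) by split => //=; rewrite in_itv/= t0t ltW.
set F := filter_prod _ _.
have FF : Filter F by exact: filter_prod_filter.
have z1 : (fun z : R * 'rV[R]_n => z.1) @ F --> (0 : R).
  apply: cvg_trans (cvg_fst (G := nbhs w)) _; exact: cvg_within.
have z2 : (fun z : R * 'rV[R]_n => z.2) @ F --> w by exact: cvg_snd.
have zpos : \forall z \near F, 0 < z.1.
  exists ([set e | 0 < e], setT) => [|z []//]; split; last exact: filterT.
  exact: nbhs_right_gt.
have mp : (t + z.1, x + z.1 *: z.2) @[z --> F] --> (t, x).
  apply: (cvg_pair (G := nbhs t) (H := nbhs x)).
    by rewrite -{2}(addr0 t); apply: cvgD; [exact: cvg_cst|exact: z1].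
  rewrite -{2}(addr0 x) -(scale0r w); apply: cvgD; first exact: cvg_cst.
  exact: cvgZ.
(* Only forward times occur, so [t = t0] is allowed, whereas [t < T] leaves room for small positive
   [z.1]. *)
have mS : \forall z \near F, strip n t0 T (t + z.1, x + z.1 *: z.2).
  have : \forall z \near F, z.1 < T - t.
    by apply: (cvgr_lt _ z1); rewrite subr_gt0.
  apply: filterS2 zpos => z z0 zT; split => //=.
  by rewrite in_itv/= (le_trans t0t) ?lerDl ?ltW//= -ltrBrDl.
pose d := 'd c (strip_nbhs t0 T (t, x)).
have dE v : d (1, v) = dt t0 T c (t, x) + dot (grad t0 T c (t, x)) v.
  by rewrite /d diff_stripE/= mul1r.
have one_z2 : (1, z.2) @[z --> F] --> ((1, w) : R * 'rV[R]_n).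
  by apply: (cvg_pair (G := nbhs (1 : R)) (H := nbhs w)) => //; exact: cvg_cst.
rewrite -dE.
have dz : d (1, z.2) @[z --> F] --> d (1, w).
  have [[dcont _]] := dc.
  exact: (@continuous_cvg _ _ _ _ _ _ _ _ (dcont (1, w))).
(* [M] bounds the norm of [(1, z.2)] for [z.2] near [w], so the tolerance [e / 2 / M] costs at most
   [e / 2] after division by [z.1]. *)
pose M := `|((1, w) : R * 'rV[R]_n)| + 1.
have M0 : 0 < M by rewrite ltr_wpDl.
have nz : \forall z \near F, `|((1, z.2) : R * 'rV[R]_n)| < M.
  by apply: (cvgr_norm_lt (V := (R * 'rV[R]_n)%type) _ one_z2); rewrite ltrDl.
apply/cvgrPdistC_le => e e0.
have e2 : 0 < e / 2 by rewrite divr_gt0.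
have e2M : 0 < e / 2 / M by rewrite divr_gt0.
move/cvgrPdistC_le : dz => /(_ _ e2) dz.
have cm := @strip_diff_cvg _ F FF _ _ _ Sp dc mp mS _ e2M.
apply: filterS3 (filterI zpos cm) nz dz => z [z0 + nzM dzw].
rewrite -/d (_ : (_, _) - (t, x) = z.1 *: (1, z.2)); last first.
  by apply: injective_projections => /=; rewrite addrAC subrr add0r// [RHS]mulr1.
rewrite linearZ normrZ (gtr0_norm z0) => cd.
set q := _ / z.1.
have qd : `|q - d (1, z.2)| <= e / 2.
  rewrite -(ler_pM2l z0) -{1}(gtr0_norm z0) -normrM mulrBr [z.1 * q]mulrC.
  rewrite divfK ?gt_eqF//; apply: le_trans cd _.
  by rewrite mulrCA ler_pM2l// mulrAC ler_pdivrMr// ler_pM2l// ltW.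
rewrite (_ : q - _ = (q - d (1, z.2)) + (d (1, z.2) - d (1, w))); last first.
  by rewrite addrA subrK.
by rewrite (le_trans (ler_normD _ _))// [leRHS]splitr lerD.
Qed.

End Strip.

(** * Real bounds on extended-real lower limits *)

Section Limf.
Context {R : realType} {T : choiceType} {X : filteredType T}.
Local Open Scope ereal_scope.
Implicit Types (g : X -> R) (F : set_system X).

Lemma limf_einf_ge0 g F {FF : Filter F} :
  (\forall z \near F, (0 <= g z)%R) -> 0 <= limf_einf (fun z => (g z)%:E) F.
Proof.
move=> g0; rewrite limf_einfE; apply: le_ereal_sup_tmp.
exists (ereal_inf ((fun z => (g z)%:E) @` [set z | (0 <= g z)%R])).
  by exists [set z | (0 <= g z)%R].
by apply: le_ereal_inf_tmp => _ [z /= z0 <-]; rewrite lee_fin.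
Qed.

(** Every member of the proper filter [F] meets the set where [g < l + e], so its infimum is at most
    [l + e]. *)
Lemma limf_einf_le g F {FF : ProperFilter F} (l : R) :
  g @ F --> l -> limf_einf (fun z => (g z)%:E) F <= l%:E.
Proof.
move=> gl; rewrite limf_einfE; apply: ge_ereal_sup => _ [V FV <-].
apply/lee_addgt0Pr => e e0.
have : \forall z \near F, (g z < l + e)%R.
  by apply: (cvgr_lt _ gl); rewrite ltrDl.
move=> /(filterI FV)/filter_ex[z [Vz gz]].
apply: ge_ereal_inf; exists (g z)%:E; first by exists z.
by rewrite -EFinD lee_fin ltW.
Qed.

Lemma limf_einf_ge0_near g F {FF : Filter F} :
  0 <= limf_einf (fun z => (g z)%:E) F ->
  forall e : R, (0 < e)%R -> \forall z \near F, (- e <= g z)%R.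
Proof.
move=> + e e0; rewrite limf_einfE => lim0.
have : (- e)%:E < ereal_sup [set ereal_inf ((fun z => (g z)%:E) @` V) | V in F].
  by apply: lt_le_trans lim0; rewrite lte_fin oppr_lt0.
move=> /ereal_sup_gt[_ [V FV <-] /ltW /ereal_infP eV].
by apply: filterS FV => z Vz; rewrite -lee_fin; apply: eV; exists z.
Qed.

End Limf.

(** * Subgradients at interior points of the strip *)

Section Subdifferential.
Context {R : realType} {n : nat} (t0 T : R).
Implicit Types (c : R * 'rV[R]_n -> R) (t a : R) (x s : 'rV[R]_n).

(** Along the ray [(t, x) + r *: h] with [r] decreasing to 0, the subgradient bounds the increment
    of [c] from below and the differential bounds it from above; then divide by [r]. *)
Lemma subdifferential_le c t x a s (h : R * 'rV[R]_n) : t \in `]t0, T[ ->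
  differentiable c (strip_nbhs t0 T (t, x)) ->
  subdifferential c t x (a, s) ->
  h.1 * a + dot s h.2 <= 'd c (strip_nbhs t0 T (t, x)) h.
Proof.
rewrite in_itv/= => /andP[t0t tT] dc /limf_einf_ge0_near sub.
(* For [h = 0] the ray would never leave the base point, which the punctured neighbourhoods
   exclude. *)
have [->|h0] := eqVneq h 0; first by rewrite diff_stripE/= !mul0r !dot0r.
have Sp : strip n t0 T (t, x) by split => //=; rewrite in_itv/= !ltW.
have D0 : 0 < `|h.1| + enorm h.2.
  rewrite lt0r paddr_eq0 ?enorm_ge0// addr_ge0 ?enorm_ge0// andbT.
  apply: contra h0 => /andP[/eqP/normr0_eq0 h10 /eqP/enorm_eq0 h20].
  by rewrite [h]surjective_pairing h10 h20.
pose m (e : R) := (t, x) + e *: h.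
pose F : set_system R := (0 : R)^'+.
have FF : ProperFilter F by exact: at_right_proper_filter.
have e0 : (fun e : R => e) @ F --> (0 : R) by exact: cvg_within.
have Fpos : \forall e \near F, 0 < e by exact: nbhs_right_gt.
have mp : m @ F --> ((t, x) : R * 'rV[R]_n).
  have : m @ F --> (t, x) + 0 *: h.
    by apply: cvgD; [exact: cvg_cst|exact: cvgZr_tmp].
  by rewrite scale0r addr0.
have mdp : m @ F --> (t, x)^'.
  move=> A /mp; rewrite /=.
  apply: filterS2 Fpos => e epos; apply.
  by rewrite /m addrC -subr_eq0 addrK scaler_eq0 negb_or gt_eqF.
have mS : \forall e \near F, strip n t0 T (m e).
  have m1 : (m e).1 @[e --> F] --> t by exact: cvg_comp mp (@cvg_fst _ _ _ _ _).
  apply: filterS2 (cvgr_gt _ m1 _ t0t) (cvgr_lt _ m1 _ tT) => e te et.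
  split => //=.
  by rewrite in_itv/= !ltW.
apply/ler_addgt0Pr => e epos.
(* [D] adds the two norms that measure the remainders: the product norm for the differential, the
   denominator of the subdifferential for the subgradient. Tolerance [e / D] for both gives a total
   error of [e]. *)
pose D := `|h| + (`|h.1| + enorm h.2).
have D'0 : 0 < D by rewrite ltr_wpDl.
have eD : 0 < e / D by rewrite divr_gt0.
have cm := @strip_diff_cvg _ _ t0 T _ F FF _ _ _ Sp dc mp mS _ eD.
suff : \forall r \near F,
    h.1 * a + dot s h.2 <= 'd c (strip_nbhs t0 T (t, x)) h + e.
  by move=> /filter_ex[].
apply: filterS3 Fpos cm (mdp _ (sub _ eD)) => r r0 /ler_normlW.
rewrite (_ : m r - (t, x) = r *: h); last by rewrite /m addrAC subrr add0r.
rewrite linearZ/= normrZ [t + _ - t]addrAC subrr add0r [x + _ - x]addrAC subrr add0r.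
rewrite enormZ dotZr [`|r *: h.1|]normrZ (gtr0_norm r0) -mulrDr ler_pdivlMr ?mulr_gt0//.
(* Scaling on [R] is converted to multiplication so that [lra] recognises the products. *)
rewrite -[r *: h.1]/(r * h.1) -[X in _ - X <= _]/(r * 'd c (strip_nbhs t0 T (t, x)) h).
have eE : e / D * D = e by rewrite divfK ?gt_eqF.
move=> cd sd; rewrite -(ler_pM2l r0) -[X in _ <= r * (_ + X)]eE.
move: (e / D) cd sd => k; rewrite /D => cd sd; lra.
Qed.

(** The one-sided inequality at [h] and at [- h] makes two linear forms equal; evaluating them on
    the basis vectors identifies their coefficients. *)
Lemma subdifferential_differentiable c t x a s : t \in `]t0, T[ ->
  differentiable c (strip_nbhs t0 T (t, x)) ->
  subdifferential c t x (a, s) ->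
  a = dt t0 T c (t, x) /\ s = grad t0 T c (t, x).
Proof.
move=> tT dc sub; have le_d h := subdifferential_le h tT dc sub.
have eq_d h : h.1 * a + dot s h.2 = 'd c (strip_nbhs t0 T (t, x)) h.
  apply/le_anti; rewrite le_d/= -lerN2 -linearN.
  by apply: le_trans (le_d _); rewrite /= mulNr dotNr opprD.
split; first by rewrite /dt -eq_d/= mul1r dot0r addr0.
by apply/rowP => j; rewrite mxE -eq_d/= mul0r add0r dot_delta.
Qed.

End Subdifferential.

Theorem proposition2 (R : realType) (n : nat) (U V : topologicalType)
  (t0 T : R) (P : set U) (Q : set V)
  (f : R -> 'rV[R]_n -> U -> V -> 'rV[R]_n)
  (sigma1 sigma2 : 'rV[R]_n -> R)
  (phi1 phi2 : R * 'rV[R]_n -> R) :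
  t0 < T ->
  P !=set0 -> compact P ->
  Q !=set0 -> compact Q ->
  {within [set z : R * 'rV[R]_n * U * V |
             [/\ z.1.1.1 \in `[t0, T], P z.1.2 & Q z.2]],
    continuous (fun z => f z.1.1.1 z.1.1.2 z.1.2 z.2)} ->
  continuous sigma1 -> continuous sigma2 ->
  (exists L : R, forall t x y u v, t \in `[t0, T] -> P u -> Q v ->
     enorm (f t x u v - f t y u v) <= L * enorm (x - y)) ->
  (exists K : R, forall t x u v, t \in `[t0, T] -> P u -> Q v ->
     enorm (f t x u v) <= K * (1 + enorm x)) ->
  isaacs P Q f t0 T ->
  differentiable_on_strip t0 T phi1 -> differentiable_on_strip t0 T phi2 ->
  (forall x, phi1 (T, x) = sigma1 x /\ phi2 (T, x) = sigma2 x) ->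
  (forall t x, t \in `[t0, T] ->
     exists un vn, [/\ P un, Q vn,
       max_on P (fun u => dot (grad t0 T phi1 (t, x)) (f t x u vn)) =
         dot (grad t0 T phi1 (t, x)) (f t x un vn),
       max_on Q (fun v => dot (grad t0 T phi2 (t, x)) (f t x un v)) =
         dot (grad t0 T phi2 (t, x)) (f t x un vn) &
       dt t0 T phi1 (t, x) + dot (grad t0 T phi1 (t, x)) (f t x un vn) = 0 /\
       dt t0 T phi2 (t, x) + dot (grad t0 T phi2 (t, x)) (f t x un vn) = 0]) ->
  [/\ {within strip n t0 T, continuous (fun p => (phi1 p, phi2 p))},
      forall x, phi1 (T, x) = sigma1 x /\ phi2 (T, x) = sigma2 x,
      upper_viscosity_solution t0 T (H1 P Q f) phi1,
      upper_viscosity_solution t0 T (H2 P Q f) phi2 &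
      forall t x, t \in `[t0, T[ ->
        ereal_inf [set d_abs phi1 phi2 t x w | w in velocities P Q f t x]
          = 0%E].
Proof.
move=> t0T P0 cP Q0 cQ fc _ _ _ _ _ d1 d2 bd eqm.
have c1 : {within strip n t0 T, continuous phi1}.
  apply/subspace_continuousP => p Sp.
  by apply: diff_strip_continuous => //; exact: d1.
have c2 : {within strip n t0 T, continuous phi2}.
  apply/subspace_continuousP => p Sp.
  by apply: diff_strip_continuous => //; exact: d2.
have fdot s : {within [set z : R * 'rV[R]_n * U * V |
      [/\ z.1.1.1 \in `[t0, T], P z.1.2 & Q z.2]],
    continuous (fun z => dot s (f z.1.1.1 z.1.1.2 z.1.2 z.2))}.
  move=> z; apply: (@continuous_comp _ _ _ _ (dot s)); first exact: fc.
  exact: continuous_dot.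
(* Continuity in each control separately is what the max-min inequality requires. *)
have fcP t x v s : t \in `[t0, T] -> Q v ->
    {within P, continuous (fun u => dot s (f t x u v))}.
  move=> tT Qv; apply: (@within_continuous_comp _ _ _ _ _
    (fun u => (t, x, u, v)) (fun z => dot s (f z.1.1.1 z.1.1.2 z.1.2 z.2)) _ _
    (fdot s)) => // u.
  by apply: (cvg_pair (G := nbhs (t, x, u)) (H := nbhs v));
    [apply: (cvg_pair (G := nbhs (t, x)) (H := nbhs u)) => //|]; exact: cvg_cst.
have fcQ t x u s : t \in `[t0, T] -> P u ->
    {within Q, continuous (fun v => dot s (f t x u v))}.
  move=> tT Pu; apply: (@within_continuous_comp _ _ _ _ _
    (fun v => (t, x, u, v)) (fun z => dot s (f z.1.1.1 z.1.1.2 z.1.2 z.2)) _ _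
    (fdot s)) => // v.
  by apply: (cvg_pair (G := nbhs (t, x, u)) (H := nbhs v)) => //; exact: cvg_cst.
have subI t : t \in `]t0, T[ -> t \in `[t0, T].
  by rewrite !in_itv/= => /andP[t0t tT]; rewrite !ltW.
have stripI t x : t \in `[t0, T] -> strip n t0 T (t, x) by [].
split=> //.
- apply/subspace_continuousP => p Sp.
  move/subspace_continuousP : c1 => /(_ p Sp) c1.
  move/subspace_continuousP : c2 => /(_ p Sp) c2.
  exact: (cvg_pair (G := nbhs (phi1 p)) (H := nbhs (phi2 p))).
- split=> // t x tT a s /(subdifferential_differentiable tT)[|-> ->].
    by apply: d1; apply: stripI; exact: subI.
  have tT' := subI t tT.
  have [un [vn [Pun Qvn maxu _ [<- _]]]] := eqm t x tT'.
  (* Zero has been replaced by the left side of the equilibrium equation. Cancelling the time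
     derivative leaves [H1] against the maximum over [P] with [vn] frozen. *)
  rewrite lerD2l -maxu; apply: (@max_min_le_max _ _ _ _ _ (fun u v => _)) => //.
    by move=> v Qv; exact: fcP.
  by move=> u Pu; exact: fcQ.
- split=> // t x tT a s /(subdifferential_differentiable tT)[|-> ->].
    by apply: d2; apply: stripI; exact: subI.
  have tT' := subI t tT.
  have [un [vn [Pun Qvn _ maxv [_ <-]]]] := eqm t x tT'.
  (* The same inequality with the players exchanged: the maximum is over [Q] and [un] is frozen. *)
  rewrite lerD2l -maxv; apply: (@max_min_le_max _ _ _ _ _ (fun v u => _)) => //.
    by move=> u Pu; exact: fcQ.
  by move=> v Qv; exact: fcP.
- move=> t x tT.
  have tT' : t \in `[t0, T].
    by move: tT; rewrite !in_itv/= => /andP[-> /ltW ->].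
  have [un [vn [Pun Qvn _ _ [e1 e2]]]] := eqm t x tT'.
  apply/le_anti/andP; split.
    (* The equilibrium velocity is a generator of the convex hull, hence an admissible [w]. *)
    apply: ge_ereal_inf; exists (d_abs phi1 phi2 t x (f t x un vn)).
      exists (f t x un vn) => //; apply: sub_gen_smallest.
      by exists (un, vn).
    apply: limf_einf_le.
    have q1 := diff_quotient_cvg (w := f t x un vn) tT (d1 _ (stripI t x tT')).
    have q2 := diff_quotient_cvg (w := f t x un vn) tT (d2 _ (stripI t x tT')).
    rewrite {}e1 in q1; rewrite {}e2 in q2.
    move/cvg_norm : q1; move/cvg_norm : q2; rewrite normr0 => q2 q1.
    have q : `|(phi1 (t + z.1, x + z.1 *: z.2) - phi1 (t, x)) / z.1| +
        `|(phi2 (t + z.1, x + z.1 *: z.2) - phi2 (t, x)) / z.1|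
        @[z --> filter_prod (0 : R)^'+ (nbhs (f t x un vn))] --> (0 : R).
      by rewrite -[X in _ --> X]addr0; exact: cvgD.
    (* The sum of absolute quotients agrees with the quotient in [d_abs] only where [z.1 > 0], which
       holds eventually along the right-hand filter. *)
    apply: cvg_trans q; apply: near_eq_cvg.
    exists ([set e | 0 < e], setT) => [|z [/= z0 _]].
      by split; [exact: nbhs_right_gt|exact: filterT].
    by rewrite !normrM normfV (gtr0_norm z0) mulrDl.
  (* For the converse bound, every [d_abs] is a lower limit of quotients that are nonnegative for
     [z.1 > 0]. *)
  apply: le_ereal_inf_tmp => _ [w _ <-]; apply: limf_einf_ge0.
  exists ([set e | 0 < e], setT) => [|z []//= z0 _].
    by split; [exact: nbhs_right_gt|exact: filterT].
  by apply: divr_ge0; [exact: addr_ge0|exact: ltW].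
Qed.
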